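(* Let $\Sigma$ be a signature, $\mathcal{V}$ a set of variables (with $\mathcal{V}\neq\emptyset$ or $\Sigma_0\neq\emptyset$) and $\kappa>0$ a cardinal. Every submultialgebra $\mathcal{A}$ of $\mathbf{mT}(\Sigma,\mathcal{V},\kappa)$ is $\mathbf{cdf}$-generated by its ground $G(\mathcal{A})$.
   Context: A signature is a family $\Sigma=\{\Sigma_n\}_{n\in\mathbb{N}}$ ($0\in\mathbb{N}$) of possibly empty sets; elements of $\Sigma_n$ are functional symbols of arity $n$. A $\Sigma$-multialgebra is a pair $\mathcal{A}=(A,\{\sigma_{\mathcal{A}}\}_{\sigma\in\Sigma})$ with $A$ a non-empty set and, for $\sigma\in\Sigma_n$, $\sigma_{\mathcal{A}}:A^n\to\mathcal{P}(A)\setminus\{\emptyset\}$ (for $\sigma\in\Sigma_0$, $\sigma_{\mathcal{A}}$ is identified with a non-empty subset of $A$). A homomorphism $f:\mathcal{A}\to\mathcal{B}$ is a function $f:A\to B$ with $\{f(a): a\in\sigma_{\mathcal{A}}(a_1,\ldots,a_n)\}\subseteq\sigma_{\mathcal{B}}(f(a_1),\ldots,f(a_n))$ for all $n$, $\sigma\in\Sigma_n$, $a_1,\ldots,a_n\in A$. $\mathcal{B}$ is a submultialgebra of $\mathcal{A}$ if $B\subseteq A$ and $\sigma_{\mathcal{B}}(b_1,\ldots,b_n)\subseteq\sigma_{\mathcal{A}}(b_1,\ldots,b_n)$ for all $\sigma\in\Sigma_n$, $b_1,\ldots,b_n\in B$. Multialgebras of terms: $T(\Sigma,\mathcal{V})$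 is the set of formal terms over $\Sigma$ with variables in $\mathcal{V}$ (the smallest set containing $\mathcal{V}\cup\Sigma_0$ and containing $\sigma\alpha_1\ldots\alpha_n$ whenever $n\ge1$, $\sigma\in\Sigma_n$ and it contains $\alpha_1,\ldots,\alpha_n$; variables and functional symbols are distinct formal symbols). For a cardinal $\kappa>0$, $\Sigma^\kappa$ is the signature with $\Sigma^\kappa_n=\Sigma_n\times\kappa$, and $(\sigma,\beta)$ is written $\sigma^\beta$. $\mathbf{mT}(\Sigma,\mathcal{V},\kappa)$ is the $\Sigma$-multialgebra with universe $T(\Sigma^\kappa,\mathcal{V})$ and $\sigma_{\mathbf{mT}(\Sigma,\mathcal{V},\kappa)}(\alpha_1,\ldots,\alpha_n)=\{\sigma^\beta\alpha_1\ldots\alpha_n:\beta\in\kappa\}$. A collection of choices $C$ from $\mathcal{A}$ to $\mathcal{B}$ consists of, for every $n$, $\sigma\in\Sigma_n$, $a_1,\ldots,a_n\in A$, $b_1,\ldots,b_n\in B$, a function $C\sigma_{a_1,\ldots,a_n}^{b_1,\ldots,b_n}:\sigma_{\mathcal{A}}(a_1,\ldots,a_n)\to\sigma_{\mathcal{B}}(b_1,\ldots,b_n)$. $\mathcal{A}$ is $\mathbf{cdf}$-generated (choice-dependent freely generated) by $X$ if $X\subseteq A$ and for every $\Sigma$-multialgebra $\mathcal{B}$, every function $f:X\to B$ and every collection of choices $C$ from $\mathcal{A}$ to $\mathcal{B}$, there is a unique homomorphism $f_C:\mathcal{A}\to\mathcal{B}$ such that $f_C|_X=f$ and $f_C|_{\sigma_{\mathcal{A}}(a_1,\ldots,a_n)}=C\sigma_{a_1,\ldots,a_n}^{f_C(a_1),\ldots,f_C(a_n)}$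 for all $\sigma\in\Sigma_n$, $a_1,\ldots,a_n\in A$. The ground of $\mathcal{A}$ is $G(\mathcal{A})=A\setminus\bigcup\{\sigma_{\mathcal{A}}(a_1,\ldots,a_n): n\in\mathbb{N},\sigma\in\Sigma_n,a_1,\ldots,a_n\in A\}$. *)

(* Defs.v *)
From mathcomp Require Import all_boot.
From mathcomp Require Import boolp classical_sets.

Set Implicit Arguments.
Unset Strict Implicit.
Unset Printing Implicit Defensive.

Local Open Scope classical_set_scope.

Definition signature := nat -> Type.

(* [A^n] is ['I_n -> A]; for [n = 0] this has exactly one element, so a nullary
   operation amounts to a non-empty subset of [A]. *)
Record multiops (Sigma : signature) (A : Type) := MultiOps {
  multiop : forall n, Sigma n -> ('I_n -> A) -> set A;
  multiop_neq0 : forall n (s : Sigma n) (a : 'I_n -> A), multiop s a !=set0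
}.

Record multialgebra (Sigma : signature) := Multialgebra {
  universe :> Type;
  universe_inhabited : inhabited universe;
  ops : multiops Sigma universe
}.

Definition op (Sigma : signature) (A : multialgebra Sigma) (n : nat)
  (s : Sigma n) (a : 'I_n -> A) : set A := multiop (ops A) s a.

Definition homomorphism (Sigma : signature) (A B : multialgebra Sigma)
    (f : A -> B) : Prop :=
  forall n (s : Sigma n) (a : 'I_n -> A), f @` op s a `<=` op s (f \o a).

(* The operations are not required to be the restrictions of those of [A]: they
   may be smaller. *)
Record submultialgebra (Sigma : signature) (A : multialgebra Sigma) :=
  Submultialgebra {
    sub_universe : set A;
    sub_universe_inhabited : inhabited sub_universe;
    sub_ops : multiops Sigma sub_universe;
    sub_ops_subset : forall n (s : Sigma n) (b : 'I_n -> sub_universe),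
      val @` multiop sub_ops s b `<=` op s (val \o b)
  }.

Definition submultialgebra_multialgebra (Sigma : signature)
    (A : multialgebra Sigma) (B : submultialgebra A) : multialgebra Sigma :=
  Multialgebra (sub_universe_inhabited B) (sub_ops B).
Coercion submultialgebra_multialgebra : submultialgebra >-> multialgebra.

(* Symbols of arity [0], applied to the empty family, are the constants. *)
Inductive term (Sigma : signature) (V : Type) : Type :=
| Var of V
| App n of Sigma n & ('I_n -> term Sigma V).
Arguments Var {Sigma V} v.
Arguments App {Sigma V n} s args.

(* A cardinal is represented by any type of that cardinality. *)
Definition signature_power (Sigma : signature) (kappa : Type) : signature :=
  fun n => (Sigma n * kappa)%type.

Section MultialgebraOfTerms.
Variables (Sigma : signature) (V kappa : Type).
Hypothesis VSigma0 : inhabited V \/ inhabited (Sigma 0).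
Hypothesis kappa0 : inhabited kappa.

Local Notation T := (term (signature_power Sigma kappa) V).

Definition mT_op n (s : Sigma n) (a : 'I_n -> T) : set T :=
  range (fun beta : kappa => App ((s, beta) : signature_power Sigma kappa n) a).

Lemma mT_op_neq0 n (s : Sigma n) (a : 'I_n -> T) : mT_op s a !=set0.
Proof. by case: kappa0 => beta; eexists; exists beta. Qed.

Lemma mT_inhabited : inhabited T.
Proof.
case: VSigma0 => -[x]; first exact: (inhabits (Var x)).
case: kappa0 => beta; apply: inhabits.
apply: (@App (signature_power Sigma kappa) V 0 (x, beta)).
by case.
Qed.

Definition mT : multialgebra Sigma :=
  Multialgebra mT_inhabited (MultiOps mT_op_neq0).

End MultialgebraOfTerms.

Definition choices (Sigma : signature) (A B : multialgebra Sigma) : Type :=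
  forall n (s : Sigma n) (a : 'I_n -> A) (b : 'I_n -> B), op s a -> op s b.

Definition cdf_generated (Sigma : signature) (A : multialgebra Sigma)
    (X : set A) : Prop :=
  forall (B : multialgebra Sigma) (f : X -> B) (C : choices A B),
    exists! fC : A -> B,
      [/\ homomorphism fC,
          forall x : X, fC (val x) = f x
        & forall n (s : Sigma n) (a : 'I_n -> A) (x : op s a),
            fC (val x) = val (C n s a (fC \o a) x)].

Arguments cdf_generated {Sigma} A X.

Definition ground (Sigma : signature) (A : multialgebra Sigma) : set A :=
  ~` [set x | exists n (s : Sigma n) (a : 'I_n -> A), op s a x].
Arguments ground {Sigma} A _.

(* Main.v *)
Require Import Defs.
From Stdlib Require Eqdep_dec PeanoNat.
From mathcomp Require Import all_boot.
From mathcomp Require Import boolp classical_sets.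

(** The operations of a submultialgebra of [mT] are contained in those of [mT],
    so an element lies in at most one set [op s a], whose arguments [a] are then
    its immediate subterms. Hence a homomorphism extending [f] and following the
    choices [C] is forced, and exists, by recursion on terms. *)

Set Implicit Arguments.
Unset Strict Implicit.
Unset Printing Implicit Defensive.

Local Open Scope classical_set_scope.

Section ChoiceRecursion.
Variables (Sigma : signature) (A : multialgebra Sigma).

Local Notation application := {n & (Sigma n * ('I_n -> A))%type}.

(** Applications are packed as dependent pairs because the two arities may differ. *)
Definition disconnected : Prop :=
  forall n (s : Sigma n) (a : 'I_n -> A) n' (s' : Sigma n') (a' : 'I_n' -> A) x,
    op s a x -> op s' a' x ->
    existT _ n (s, a) = existT _ n' (s', a') :> application.

Definition immediate_part (y x : A) : Prop :=
  exists n (s : Sigma n) (a : 'I_n -> A) i, op s a x /\ y = a i.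

Hypothesis Adisc : disconnected.
Hypothesis Awf : well_founded immediate_part.

Variables (B : multialgebra Sigma) (f : ground A -> B) (C : choices A B).

(** The extension is built first as a relation: [C] is indexed by the values [b] at the arguments,
    so these are guessed and required to be related to [a]. *)
Inductive choice_graph : A -> B -> Prop :=
| choice_graph_ground (x : ground A) : choice_graph (val x) (f x)
| choice_graph_op n (s : Sigma n) (a : 'I_n -> A) (b : 'I_n -> B) (x : op s a) :
    (forall i, choice_graph (a i) (b i)) ->
    choice_graph (val x) (val (C b x)).

(** A value of an operation is not in the ground, so the second rule was used last; by
    disconnectedness it was used with the same [s] and [a]. *)
Lemma choice_graph_op_inv n (s : Sigma n) (a : 'I_n -> A) (x : op s a) y :
  choice_graph (val x) y ->
  exists2 b, forall i, choice_graph (a i) (b i) & y = val (C b x).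
Proof.
move=> xy; move: {-2}(val x) xy (erefl (val x)) => x' [{}x' | n' s' a' b' {}x' ab'] ex.
  case: (set_valP x'); exists n, s, a.
  by rewrite -ex; exact: set_valP.
have opx : op s a (val x') by rewrite -ex; exact: set_valP.
have := Adisc opx (set_valP x').
(* The type of [x] depends on [s] and [a]; stating the goal for an arbitrary packed application [d]
   allows rewriting with the equality of applications. *)
suff gen (d : application) (z : op (tagged d).1 (tagged d).2) :
    val z = val x' -> d = existT _ n' (s', a') ->
    exists2 b, forall i, choice_graph ((tagged d).2 i) (b i) &
      val (C b' x') = val (C b z).
  exact: (gen (existT _ n (s, a))).
move=> zx' ed; move: z zx'; rewrite {}ed /= => z /val_inj ->.
by exists b'.
Qed.

Lemma choice_graph_functional x y y' :
  choice_graph x y -> choice_graph x y' -> y = y'.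
Proof.
elim/(well_founded_ind Awf): x y y' => x IH y y' xy.
case: {x} xy IH (xy) => [x _ _ | n s a b x _ IH xy].
  move: {-2}(val x) (erefl (val x)) => x' ex xy'.
  case: xy' ex => [{}x' /val_inj -> // | n s a b {}x' _ ex].
  by case: (set_valP x); exists n, s, a; rewrite -ex; exact: set_valP.
have [b1 ab1 ->] := choice_graph_op_inv xy.
move=> /choice_graph_op_inv [b2 ab2 ->].
suff -> : b1 = b2 by [].
apply/funext => i; apply: (IH (a i)); [|exact: ab1|exact: ab2].
by exists n, s, a, i; split=> //; exact: set_valP.
Qed.

Lemma ground_or_op (x : A) :
  (exists x' : ground A, val x' = x) \/
  exists n (s : Sigma n) (a : 'I_n -> A) (x' : op s a), val x' = x.
Proof.
have [[n [s [a opx]]]|gx] := pselect (exists n (s : Sigma n) a, op s a x).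
  by right; exists n, s, a, (SigSub (mem_set opx)).
by left; exists (SigSub (mem_set (gx : ground A x))).
Qed.

Lemma choice_graph_total x : exists y, choice_graph x y.
Proof.
elim/(well_founded_ind Awf): x => x IH.
have [[x' <-]|[n [s [a [x' ex]]]]] := ground_or_op x.
  by exists (f x'); exact: choice_graph_ground.
have /choice[b ab] : forall i, exists y, choice_graph (a i) y.
  move=> i; apply: IH; exists n, s, a, i; split=> //.
  by rewrite -ex; exact: set_valP.
by rewrite -ex; exists (val (C b x')); exact: choice_graph_op.
Qed.

(** This yields uniqueness: every extension lies inside one functional relation. *)
Lemma choice_graph_of_extension (g : A -> B) :
  (forall x : ground A, g (val x) = f x) ->
  (forall n (s : Sigma n) (a : 'I_n -> A) (x : op s a),
     g (val x) = val (C (g \o a) x)) ->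
  forall x, choice_graph x (g x).
Proof.
move=> gf gC; elim/(well_founded_ind Awf) => x IH.
have [[x' <-]|[n [s [a [x' ex]]]]] := ground_or_op x.
  by rewrite gf; exact: choice_graph_ground.
rewrite -ex gC; apply: choice_graph_op => i /=; apply: IH.
by exists n, s, a, i; split=> //; rewrite -ex; exact: set_valP.
Qed.

Lemma choice_extension_unique :
  exists! fC : A -> B,
    [/\ homomorphism fC,
        forall x : ground A, fC (val x) = f x
      & forall n (s : Sigma n) (a : 'I_n -> A) (x : op s a),
          fC (val x) = val (C (fC \o a) x)].
Proof.
have [g xg] := choice choice_graph_total.
have gC n (s : Sigma n) (a : 'I_n -> A) (x : op s a) :
    g (val x) = val (C (g \o a) x).
  have [b ab ->] := choice_graph_op_inv (xg (val x)).
  suff -> : b = g \o a by [].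
  by apply/funext => i; exact: choice_graph_functional (ab i) (xg (a i)).
exists g; split; first split=> //.
- move=> n s a _ [x opx <-].
  (* The homomorphism property is automatic, since choices take their values in [op s (g \o a)]. *)
  by rewrite (gC _ _ _ (SigSub (mem_set opx))); exact: set_valP.
- by move=> x; exact: choice_graph_functional (xg _) (choice_graph_ground x).
move=> h [_ hf hC]; apply/funext => x.
exact: choice_graph_functional (xg x) (choice_graph_of_extension hf hC x).
Qed.

End ChoiceRecursion.

Lemma disconnected_wf_cdf_generated (Sigma : signature) (A : multialgebra Sigma) :
  disconnected A -> well_founded (@immediate_part Sigma A) ->
  cdf_generated A (ground A).
Proof. by move=> Adisc Awf B f C; exact: choice_extension_unique. Qed.

Lemma App_arity (Sigma : signature) (V : Type) n n' (s : Sigma n) (s' : Sigma n')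
    (a : 'I_n -> term Sigma V) (a' : 'I_n' -> term Sigma V) :
  App s a = App s' a' -> n = n'.
Proof. by case. Qed.

Lemma App_inj (Sigma : signature) (V : Type) n (s s' : Sigma n)
    (a a' : 'I_n -> term Sigma V) :
  App s a = App s' a' -> s = s' /\ a = a'.
Proof.
(* [args] gathers symbol and arguments into a pair depending on the arity alone; equality of arities
   is decidable, so the second components can be compared. *)
pose args (t : term Sigma V) :=
  if t is App m r b then
    Some (existT (fun m => (Sigma m * ('I_m -> term Sigma V))%type) m (r, b))
  else None.
move=> /(congr1 args) /Some_inj.
by move/(Eqdep_dec.inj_pair2_eq_dec _ PeanoNat.Nat.eq_dec _ _ _ _) => [-> ->].
Qed.

Section SubmultialgebraOfTerms.
Variables (Sigma : signature) (V kappa : Type).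
Hypothesis VSigma0 : inhabited V \/ inhabited (Sigma 0).
Hypothesis kappa0 : inhabited kappa.
Variable A : submultialgebra (mT VSigma0 kappa0).

Lemma submT_opP n (s : Sigma n) (a : 'I_n -> A) (x : A) :
  op s a x ->
  exists beta : kappa,
    val x = App ((s, beta) : signature_power Sigma kappa n) (val \o a).
Proof.
move=> opx; have [|beta _ <-] := @sub_ops_subset _ _ A n s a (val x).
  by exists x.
by exists beta.
Qed.

(** The underlying term of [x] determines its head symbol and arguments; the superscripts [beta] and
    [beta'] are then forgotten. *)
Lemma submT_disconnected : disconnected A.
Proof.
move=> n s a n' s' a' x /submT_opP[beta xE] /submT_opP[beta' xE'].
move: (etrans (esym xE) xE') => e; have en := App_arity e.
subst n'; have [[-> _] ea] := App_inj e.
suff -> : a = a' by [].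
apply/funext => i; apply: val_inj.
by have := congr1 (fun h => h i) ea.
Qed.

(** Immediate parts in [A] are immediate subterms, so structural induction applies to the underlying
    term [t], with [x] left general. *)
Lemma submT_wf : well_founded (@immediate_part Sigma A).
Proof.
suff acc t (x : A) : val x = t -> Acc (@immediate_part Sigma A) x.
  by move=> x; exact: acc.
elim: t x => [v | n s a IH] x xE; apply: Acc_intro => _ [m [s' [b [i [opx ->]]]]].
  (* A variable is never a value of an operation. *)
  by have [beta /(etrans (esym xE))] := submT_opP opx.
have [beta /(etrans (esym xE)) e] := submT_opP opx.
have en := App_arity e; subst m; have [_ ea] := App_inj e.
by apply: (IH i); have := congr1 (fun h => h i) ea.
Qed.

End SubmultialgebraOfTerms.

Theorem theorem1 (Sigma : signature) (V kappa : Type)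
    (VSigma0 : inhabited V \/ inhabited (Sigma 0))
    (kappa0 : inhabited kappa)
    (A : submultialgebra (mT VSigma0 kappa0)) :
  cdf_generated A (ground A).
Proof.
by apply: disconnected_wf_cdf_generated; [exact: submT_disconnected | exact: submT_wf].
Qed.
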